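(* Let $q$ be a complex number with $|q|<1$. Then $$\sum_{k=0}^\infty\frac{(-1)^kq^{k(k+3)/2}}{1-q^{2k+1}}=\frac{(q^2;q^2)_{\infty}(q^8;q^8)_{\infty}}{(q;q^2)_{\infty}(q^4;q^8)_{\infty}}.$$
   Context: For a complex number $a$ and $|q|<1$, $(a;q)_\infty=\prod_{k=0}^{\infty}(1-aq^k)$. *)

(* Defs.v *)
From Stdlib Require Import Reals Lra Lia.
From Coquelicot Require Import Coquelicot.

Open Scope C_scope.

(* Like Coquelicot's [C_lim], componentwise; a junk value when [u] diverges. *)
Definition C_lim_seq (u : nat -> C) : C :=
  (real (Lim_seq (fun n => Re (u n))), real (Lim_seq (fun n => Im (u n)))).

(* [qpoch a q n] is (a;q)_n, the product of the n factors 1 - a q^k, k < n. *)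
Fixpoint qpoch (a q : C) (n : nat) : C :=
  match n with
  | O => 1
  | S m => qpoch a q m * (1 - a * q ^ m)
  end.

Definition qpoch_inf (a q : C) : C := C_lim_seq (qpoch a q).

Lemma C_lim_seq_unique (u : nat -> C) (l : C) :
  filterlim u eventually (locally l) -> C_lim_seq u = l.
Proof.
intros H.
assert (Hr : is_lim_seq (fun n => Re (u n)) (Re l)).
{ intros P [e He]; apply (H (fun z : C => P (Re z))).
  exists e; intros y [Hy _]; exact (He _ Hy). }
assert (Hi : is_lim_seq (fun n => Im (u n)) (Im l)).
{ intros P [e He]; apply (H (fun z : C => P (Im z))).
  exists e; intros y [_ Hy]; exact (He _ Hy). }
unfold C_lim_seq.
rewrite (is_lim_seq_unique _ _ Hr), (is_lim_seq_unique _ _ Hi).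
now destruct l.
Qed.

Lemma Cmod_Cpow (q : C) (n : nat) : Cmod (q ^ n) = (Cmod q ^ n)%R.
Proof.
induction n as [|n IH]; simpl; [apply Cmod_1|now rewrite Cmod_mult, IH].
Qed.

Lemma qpoch_bound (a q : C) (n : nat) : (Cmod q < 1)%R ->
  (Cmod (qpoch a q n) <= exp (Cmod a / (1 - Cmod q)))%R.
Proof.
intros hq.
assert (Hpow : forall m, (0 <= Cmod q ^ m)%R)
  by (intros m; apply pow_le, Cmod_ge_0).
apply Rle_trans with (exp (Cmod a * (1 - Cmod q ^ n) / (1 - Cmod q)))%R.
- induction n as [|n IH].
  + simpl; rewrite Cmod_1.
    replace (Cmod a * (1 - 1) / (1 - Cmod q))%R with 0%R by (field; lra).
    rewrite exp_0; lra.
  + simpl qpoch; rewrite Cmod_mult.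
    replace (Cmod a * (1 - Cmod q ^ S n) / (1 - Cmod q))%R
      with (Cmod a * (1 - Cmod q ^ n) / (1 - Cmod q) + Cmod a * Cmod q ^ n)%R
      by (simpl; field; lra).
    rewrite exp_plus.
    apply Rmult_le_compat; try apply Cmod_ge_0; [exact IH|].
    apply Rle_trans with (1 + Cmod a * Cmod q ^ n)%R; [|apply exp_ineq1_le].
    unfold Cminus.
    eapply Rle_trans; [apply Cmod_triangle|].
    rewrite Cmod_1, Cmod_opp, Cmod_mult, Cmod_Cpow; lra.
- assert (exp_le : forall x y, (x <= y -> exp x <= exp y)%R)
    by (intros x y [h| ->]; [left; now apply exp_increasing|right; reflexivity]).
  apply exp_le, Rmult_le_compat_r.
  + left; apply Rinv_0_lt_compat; lra.
  + generalize (Cmod_ge_0 a) (Hpow n); nra.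
Qed.

Lemma ex_lim_seq_geom (u : nat -> R) (K r : R) : (0 <= r < 1)%R ->
  (forall n, (Rabs (u (S n) - u n) <= K * r ^ n)%R) ->
  exists l : R, is_lim_seq u l.
Proof.
intros hr Hu.
assert (Hs : ex_series (fun n => (u (S n) - u n)%R)).
{ apply (ex_series_le (K := R_AbsRing) (V := R_CompleteNormedModule)
           _ (fun n => K * r ^ n)%R); [exact Hu|].
  apply (ex_series_scal_l (K := R_AbsRing) K (fun n => r ^ n)%R).
  exists (/ (1 - r))%R; apply is_series_geom.
  rewrite Rabs_pos_eq; lra. }
destruct Hs as [s Hs]; exists (s + u O)%R.
apply is_lim_seq_incr_1.
apply is_lim_seq_ext
  with (fun n => sum_n (fun k => u (S k) - u k)%R n + u O)%R.
- induction n as [|n IH].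
  + rewrite sum_O; ring.
  + rewrite sum_Sn, <- IH; unfold plus; simpl; ring.
- apply (is_lim_seq_plus' _ _ s (u O)); [exact Hs|apply is_lim_seq_const].
Qed.

Lemma qpoch_inf_correct (a q : C) : (Cmod q < 1)%R ->
  filterlim (qpoch a q) eventually (locally (qpoch_inf a q)).
Proof.
intros hq.
set (K := (exp (Cmod a / (1 - Cmod q)) * Cmod a)%R).
assert (Hd : forall n,
  (Cmod (qpoch a q (S n) - qpoch a q n) <= K * Cmod q ^ n)%R).
{ intros n; simpl qpoch.
  replace (qpoch a q n * (1 - a * q ^ n) - qpoch a q n)
    with (- (qpoch a q n * a * q ^ n)) by ring.
  rewrite Cmod_opp, !Cmod_mult, Cmod_Cpow.
  apply Rmult_le_compat_r; [apply pow_le, Cmod_ge_0|].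
  apply Rmult_le_compat_r; [apply Cmod_ge_0|].
  now apply qpoch_bound. }
assert (hr : (0 <= Cmod q < 1)%R) by (split; [apply Cmod_ge_0|exact hq]).
destruct (ex_lim_seq_geom (fun n => Re (qpoch a q n)) K (Cmod q) hr)
  as [x Hx].
{ intros n; eapply Rle_trans; [|apply Hd].
  eapply Rle_trans; [|apply Rmax_Cmod]; apply Rmax_l. }
destruct (ex_lim_seq_geom (fun n => Im (qpoch a q n)) K (Cmod q) hr)
  as [y Hy].
{ intros n; eapply Rle_trans; [|apply Hd].
  eapply Rle_trans; [|apply Rmax_Cmod]; apply Rmax_r. }
assert (H : filterlim (qpoch a q) eventually (locally ((x, y) : C))).
{ intros P [e He].
  assert (Bx := Hx _ (locally_ball x e)).
  assert (By := Hy _ (locally_ball y e)).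
  destruct Bx as [N1 H1]; destruct By as [N2 H2].
  exists (max N1 N2); intros n hn; apply He.
  split; [apply H1|apply H2]; lia. }
unfold qpoch_inf; now rewrite (C_lim_seq_unique _ _ H).
Qed.

(* Main.v *)
Require Import Defs.
From Stdlib Require Import Reals Lra Lia.
From Coquelicot Require Import Coquelicot.

(** Put [P = q^8], [b = q^5], [c = q], [a = b c = q^6], and write [t k] for the
    [k]-th term of the series. Then
      [t (4j) + t (4j+2) = P^(j^2) a^j (1 - a P^(2j)) / ((1 - b P^j) (1 - c P^j))],
    and [t (4j+1) + t (4j+3)] is the same expression with [-j-1] for [j], so the
    series is the bilateral sum of the right-hand side over the integers.
    With [a] fixed, [(1 - b P^j) (1 - c P^j)] is linear in [X = b + c] and
    vanishes at [X = P^-j + a P^j]; the partial fraction expansion in [X] of the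
    inverse of the product of these factors over a window [-N-1 <= j <= N] has
    explicit q-factorial weights. As [N] grows, all weights tend to
    [1 / ((P;P)^2 (a;P) (P/a;P))], geometrically in [N - |j|], which is enough to
    pass to the limit under the sum. *)

Open Scope C_scope.

(** * Finite sums and products *)

Fixpoint csum (f : nat -> C) (n : nat) : C :=
  match n with
  | O => 0
  | S m => csum f m + f m
  end.

Fixpoint cprod (f : nat -> C) (n : nat) : C :=
  match n with
  | O => 1
  | S m => cprod f m * f m
  end.

Lemma csum_ext (f g : nat -> C) (n : nat) :
  (forall i, (i < n)%nat -> f i = g i) -> csum f n = csum g n.
Proof.
induction n as [|n IH]; intros H; simpl; [reflexivity|].
rewrite IH, H; auto with arith.
Qed.

Lemma csum_plus (f g : nat -> C) (n : nat) :
  csum (fun i => f i + g i) n = csum f n + csum g n.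
Proof. induction n as [|n IH]; simpl; [|rewrite IH]; ring. Qed.

Lemma csum_scal (c : C) (f : nat -> C) (n : nat) :
  csum (fun i => c * f i) n = c * csum f n.
Proof. induction n as [|n IH]; simpl; [|rewrite IH]; ring. Qed.

Lemma csum_double (f : nat -> C) (n : nat) :
  csum f (2 * n) = csum (fun j => f (2 * j)%nat + f (2 * j + 1)%nat) n.
Proof.
induction n as [|n IH]; [reflexivity|].
replace (2 * S n)%nat with (S (S (2 * n))) by lia; cbn [csum].
rewrite IH; replace (S (2 * n)) with (2 * n + 1)%nat by lia; ring.
Qed.

Lemma cprod_ext (f g : nat -> C) (n : nat) :
  (forall i, (i < n)%nat -> f i = g i) -> cprod f n = cprod g n.
Proof.
induction n as [|n IH]; intros H; simpl; [reflexivity|].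
rewrite IH, H; auto with arith.
Qed.

Lemma cprod_mult (f g : nat -> C) (n : nat) :
  cprod (fun i => f i * g i) n = cprod f n * cprod g n.
Proof. induction n as [|n IH]; simpl; [|rewrite IH]; ring. Qed.

Lemma cprod_double (f : nat -> C) (n : nat) :
  cprod f (2 * n) = cprod (fun j => f (2 * j)%nat * f (2 * j + 1)%nat) n.
Proof.
induction n as [|n IH]; [reflexivity|].
replace (2 * S n)%nat with (S (S (2 * n))) by lia; cbn [cprod].
rewrite IH; replace (S (2 * n)) with (2 * n + 1)%nat by lia; ring.
Qed.

Lemma cprod_shift (f : nat -> C) (n : nat) :
  cprod f (S n) = f O * cprod (fun i => f (S i)) n.
Proof.
induction n as [|n IH]; [simpl; ring|].
change (cprod f (S (S n))) with (cprod f (S n) * f (S n)).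
rewrite IH; simpl; ring.
Qed.

Lemma cprod_rev (f : nat -> C) (n : nat) :
  cprod f n = cprod (fun i => f (n - 1 - i)%nat) n.
Proof.
induction n as [|n IH]; [reflexivity|].
rewrite (cprod_shift (fun i => f (S n - 1 - i)%nat)).
change (cprod f (S n)) with (cprod f n * f n); rewrite IH, Cmult_comm.
f_equal; [f_equal; lia|].
apply cprod_ext; intros i Hi; f_equal; lia.
Qed.

Lemma cprod_neq_0 (f : nat -> C) (n : nat) :
  (forall i, (i < n)%nat -> f i <> 0) -> cprod f n <> 0.
Proof.
induction n as [|n IH]; intros H; simpl; [exact C1_nz|].
apply Cmult_neq_0; auto with arith.
Qed.

(** * Partial fractions with simple poles *)

Lemma Cminus_neq_0 (a b : C) : a <> b -> a - b <> 0.
Proof.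
intros H E; apply H.
replace a with (a - b + b) by ring; rewrite E; ring.
Qed.

(** Induction on the number of nodes. Dividing the identity for the old nodes by the new factor
    splits each term through [1/((x-X)(y-X)) = (1/(x-X) - 1/(y-X))/(y-x)]. The scalars [s] allow
    factors that are linear in [X] without being monic. *)
Lemma partial_fractions (s x : nat -> C) (n : nat) :
  (forall i, s i <> 0) ->
  (forall i j, (i <= n)%nat -> (j <= n)%nat -> i <> j -> x i <> x j) ->
  forall X, (forall i, (i <= n)%nat -> x i <> X) ->
  csum (fun i => / (s i * (x i - X)
    * cprod (fun l => if Nat.eqb l i then 1 else s l * (x l - x i)) (S n))) (S n)
  = / cprod (fun i => s i * (x i - X)) (S n).
Proof.
intros Hs; induction n as [|n IH]; intros Hx X HX.
{ simpl; field; split; [apply Cminus_neq_0, HX; lia|apply Hs]. }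
specialize (IH (fun i j hi hj => Hx i j ltac:(lia) ltac:(lia))).
set (c := fun i =>
  cprod (fun l => if Nat.eqb l i then 1 else s l * (x l - x i)) (S n)).
assert (Hc : forall i, (i <= n)%nat -> c i <> 0).
{ intros i hi; apply cprod_neq_0; intros l hl.
  destruct (Nat.eqb_spec l i) as [e|e]; [exact C1_nz|].
  apply Cmult_neq_0; [apply Hs|apply Cminus_neq_0, Hx; lia]. }
assert (HM : x (S n) - X <> 0) by (apply Cminus_neq_0, HX; lia).
transitivity (/ (s (S n) * (x (S n) - X))
  * csum (fun i => / (s i * (x i - X) * c i)) (S n)).
2:{ unfold c; rewrite IH by (intros i hi; apply HX; lia).
    cbn [cprod]; field.
    repeat split; auto using Hs.
    + apply Cminus_neq_0, HX; lia.
    + apply cprod_neq_0; intros i hi.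
      apply Cmult_neq_0; [apply Hs|apply Cminus_neq_0, HX; lia]. }
change (csum ?f (S (S n))) with (csum f (S n) + f (S n)); cbv beta.
(* The induction hypothesis, taken this time at [X = x (S n)], turns the coefficient of the new node
   into a sum over the old nodes, so that the identity can be checked term by term. *)
match goal with |- _ + ?t = _ =>
  replace t with (/ (s (S n) * (x (S n) - X))
    * csum (fun i => / (s i * (x i - x (S n)) * c i)) (S n)) end.
2:{ unfold c; rewrite IH by (intros i hi; apply Hx; lia).
    cbn [cprod]; rewrite Nat.eqb_refl.
    replace (Nat.eqb n (S n)) with false by (symmetry; apply Nat.eqb_neq; lia).
    rewrite (cprod_ext (fun l => if Nat.eqb l (S n) then 1
                else s l * (x l - x (S n))) (fun i => s i * (x i - x (S n)))).
    2:{ intros i hi; destruct (Nat.eqb_spec i (S n)); [lia|reflexivity]. }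
    field; repeat split; auto using Hs.
    + apply Cminus_neq_0, Hx; lia.
    + apply cprod_neq_0; intros i hi.
      apply Cmult_neq_0; [apply Hs|apply Cminus_neq_0, Hx; lia]. }
rewrite <- !csum_scal, <- csum_plus; apply csum_ext; intros i hi.
change (cprod ?f (S (S n))) with (cprod f (S n) * f (S n)); cbv beta.
fold (c i).
destruct (Nat.eqb_spec (S n) i) as [e|_]; [lia|].
field; repeat split; auto using Hs;
  first [apply Hc; lia | apply Cminus_neq_0, Hx; lia | apply Cminus_neq_0, HX; lia].
Qed.

(** * Products over the nodes as q-factorials *)

Lemma qpoch_cprod (a q : C) (n : nat) :
  qpoch a q n = cprod (fun k => 1 - a * q ^ k) n.
Proof. induction n as [|n IH]; simpl; [|rewrite IH]; reflexivity. Qed.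

Lemma qpoch_add (a q : C) (m n : nat) :
  qpoch a q (m + n) = qpoch a q m * cprod (fun k => 1 - a * q ^ (m + k)) n.
Proof.
induction n as [|n IH].
- rewrite Nat.add_0_r; simpl; ring.
- rewrite Nat.add_succ_r; simpl; rewrite IH; ring.
Qed.

(** These are the factors of a node product in which the exponent of [P] is nonpositive. After the
    reversal [n = j-1-i], pulling out [-P^(-i-1)] and [-P^(-i)/a] leaves [1 - P^(i+1)] and
    [1 - a P^i]; the signs cancel in pairs and the exponents [2i+1] add up to [j^2]. *)
Lemma cprod_reflect (P a : C) (j : nat) : P <> 0 -> a <> 0 ->
  cprod (fun n => (1 - P ^ n / P ^ j) * (1 - P ^ (n + 1) / (P ^ j * a))) j
  = qpoch P P j * qpoch a P j / (P ^ (j * j) * a ^ j).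
Proof.
intros HP Ha.
rewrite cprod_rev, !qpoch_cprod.
rewrite (cprod_ext _ (fun i => / (P ^ (2 * i + 1) * a)
           * ((1 - P * P ^ i) * (1 - a * P ^ i)))).
2:{ intros i hi.
    set (m := (j - 1 - i)%nat).
    replace j with (m + i + 1)%nat by lia.
    replace (2 * i + 1)%nat with (i + i + 1)%nat by lia.
    rewrite !Cpow_add_r, Cpow_1_r.
    assert (H1 := Cpow_nz P m HP); assert (H2 := Cpow_nz P i HP).
    field; repeat split; assumption. }
rewrite !cprod_mult.
replace (cprod (fun i => / (P ^ (2 * i + 1) * a)) j)
  with (/ (P ^ (j * j) * a ^ j)).
{ unfold Cdiv; ring. }
clear -HP Ha; induction j as [|j IH].
- simpl; field.
- cbn [cprod]; rewrite <- IH.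
  replace (S j * S j)%nat with (j * j + (2 * j + 1))%nat by lia.
  rewrite Cpow_S, !Cpow_add_r.
  assert (H1 := Cpow_nz P (2 * j) HP); assert (H2 := Cpow_nz P (j * j) HP).
  assert (H3 := Cpow_nz a j Ha).
  rewrite Cpow_1_r; field; repeat split; assumption.
Qed.

(** This is the denominator of the partial fraction weight of the node [j] in the window with
    [N = j + m]: the index [n] collects the differences to the nodes [n] and [-n-1]. The case
    [m = 0] comes from [cprod_reflect], and each further [n] lengthens the four q-factorials by one
    factor. The division by [1 - a P^(2j)] accounts for the omitted difference at [n = j]. *)
Lemma node_product (P a : C) (j m : nat) :
  P <> 0 -> a <> 0 -> 1 - a * P ^ (2 * j) <> 0 ->
  cprod (fun n =>
    (if Nat.eqb n j then 1 else (1 - P ^ n / P ^ j) * (1 - a * P ^ (n + j)))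
    * ((1 - P ^ (n + j + 1)) * (1 - P ^ (n + 1) / (P ^ j * a)))) (j + 1 + m)
  = qpoch P P m * qpoch P P (m + 2 * j + 1) * qpoch a P (m + 2 * j + 1)
    * qpoch (P / a) P (m + 1)
    / (P ^ (j * j) * a ^ j * (1 - a * P ^ (2 * j))).
Proof.
intros HP Ha Hj.
assert (H0 := Cpow_nz P j HP).
assert (H2 := Cpow_nz P (j * j) HP); assert (H3 := Cpow_nz a j Ha).
induction m as [|m IH].
- rewrite Nat.add_0_r, Nat.add_1_r.
  change (cprod ?f (S j)) with (cprod f j * f j); cbv beta.
  rewrite Nat.eqb_refl.
  rewrite (cprod_ext _ (fun n =>
    (1 - P ^ n / P ^ j) * (1 - P ^ (n + 1) / (P ^ j * a))
    * ((1 - P * P ^ (j + n)) * (1 - a * P ^ (j + n))))).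
  2:{ intros n hn; destruct (Nat.eqb_spec n j) as [e|_]; [lia|].
      rewrite (Nat.add_comm n j), (Cpow_add_r P (j + n) 1), Cpow_1_r; ring. }
  rewrite !cprod_mult, <- cprod_mult, cprod_reflect by assumption.
  replace (0 + 2 * j + 1)%nat with (S (j + j)) by lia.
  cbn [qpoch Nat.add]; rewrite !qpoch_add.
  replace (2 * j)%nat with (j + j)%nat in * by lia.
  rewrite Cpow_add_r in Hj.
  rewrite !Cpow_add_r, Cpow_1_r.
  change (P ^ 0) with (RtoC 1).
  field; repeat split; assumption.
- replace (j + 1 + S m)%nat with (S (j + 1 + m)) by lia.
  change (cprod ?f (S (j + 1 + m)))
    with (cprod f (j + 1 + m) * f (j + 1 + m)%nat); cbv beta.
  rewrite IH.
  destruct (Nat.eqb_spec (j + 1 + m) j) as [e|_]; [lia|].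
  replace (S m + 2 * j + 1)%nat with (S (m + 2 * j + 1)) by lia.
  replace (S m + 1)%nat with (S (m + 1)) by lia.
  cbn [qpoch].
  replace (2 * j)%nat with (j + j)%nat in * by lia.
  rewrite Cpow_add_r in Hj.
  rewrite !Cpow_add_r, Cpow_1_r.
  field; repeat split; assumption.
Qed.

(** * The bilateral partial fraction expansion *)

Lemma Cpow_inj (P : C) (k l : nat) : P <> 0 ->
  (forall n, P ^ (n + 1) <> 1) -> k <> l -> P ^ k <> P ^ l.
Proof.
intros HP H1.
assert (W : forall k d, P ^ (k + (d + 1)) <> P ^ k).
{ intros i d E; apply (H1 d).
  apply (f_equal (fun z => z / P ^ i)) in E.
  assert (H0 := Cpow_nz P i HP).
  rewrite Cpow_add_r in E.
  replace (P ^ (d + 1)) with (P ^ i * P ^ (d + 1) / P ^ i) by (field; assumption).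
  rewrite E; field; assumption. }
intros kl E; destruct (Nat.lt_ge_cases k l) as [h|h].
- apply (W k (l - k - 1)%nat); rewrite E; f_equal; lia.
- apply (W l (k - l - 1)%nat); rewrite <- E; f_equal; lia.
Qed.

(* The node [j] sits at index [2 j] and the node [-j-1] at index [2 j + 1]; the
   substitution [a -> a' = P^2 / a] exchanges the two halves. *)
Lemma bilateral_partial_fractions (P a a' b c : C) (N : nat) :
  P <> 0 -> b <> 0 -> c <> 0 -> a = b * c -> a' = P ^ 2 / (b * c) ->
  (forall n, P ^ (n + 1) <> 1) ->
  (forall n, a * P ^ n <> 1) -> (forall n, P ^ (n + 1) <> a) ->
  (forall n, 1 - b * P ^ n <> 0) -> (forall n, 1 - c * P ^ n <> 0) ->
  (forall n, 1 - P ^ (n + 1) / b <> 0) -> (forall n, 1 - P ^ (n + 1) / c <> 0) ->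
  csum (fun j =>
      P ^ (j * j) * a ^ j * (1 - a * P ^ (2 * j))
      / (qpoch P P (N - j) * qpoch P P (N + j + 1)
         * qpoch a P (N + j + 1) * qpoch (P / a) P (N - j + 1))
      / ((1 - b * P ^ j) * (1 - c * P ^ j))
    + P ^ (j * j) * a' ^ j * (1 - a' * P ^ (2 * j))
      / (qpoch P P (N - j) * qpoch P P (N + j + 1)
         * qpoch a' P (N + j + 1) * qpoch (P / a') P (N - j + 1))
      / ((1 - P ^ (j + 1) / b) * (1 - P ^ (j + 1) / c))) (S N)
  = / cprod (fun j => (1 - b * P ^ j) * (1 - c * P ^ j)
        * ((1 - P ^ (j + 1) / b) * (1 - P ^ (j + 1) / c))) (S N).
Proof.
intros HP Hb Hc Ea Ea' H1 Ha1 HaP Hb1 Hc1 HbP HcP.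
assert (Ha : a <> 0) by (rewrite Ea; now apply Cmult_neq_0).
assert (HPn : forall n, P ^ n <> 0) by (intros; now apply Cpow_nz).
assert (Ha' : a' <> 0).
{ rewrite Ea'; apply Cmult_neq_0; [apply HPn|].
  intros E; apply C1_nz; rewrite <- (Cinv_r (b * c)), E; [ring|].
  now apply Cmult_neq_0. }
(* [x i] is the value of [X = b + c] at which the factor vanishes, and [s i] is minus its
   coefficient of [X]. At the node [-j-1] the factor is multiplied by [P^(2j+2)/a], which makes it
   [(1 - P^(j+1)/b)(1 - P^(j+1)/c)], hence the scalar [P^(j+1)/a] in place of [P^(-j-1)]. *)
set (s := fun i => let j := Nat.div2 i in
  if Nat.even i then P ^ j else P ^ (j + 1) / a).
set (x := fun i => let j := Nat.div2 i in
  if Nat.even i then / P ^ j + a * P ^ j else P ^ (j + 1) + a / P ^ (j + 1)).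
assert (s0 : forall j, s (2 * j)%nat = P ^ j).
{ intros j; unfold s; now rewrite Nat.even_even, Nat.div2_double. }
assert (s1 : forall j, s (2 * j + 1)%nat = P ^ (j + 1) / a).
{ intros j; unfold s; rewrite Nat.even_odd, (Nat.add_1_r (2 * j)).
  now rewrite Nat.div2_succ_double. }
assert (x0 : forall j, x (2 * j)%nat = / P ^ j + a * P ^ j).
{ intros j; unfold x; now rewrite Nat.even_even, Nat.div2_double. }
assert (x1 : forall j, x (2 * j + 1)%nat = P ^ (j + 1) + a / P ^ (j + 1)).
{ intros j; unfold x; rewrite Nat.even_odd, (Nat.add_1_r (2 * j)).
  now rewrite Nat.div2_succ_double. }
assert (par : forall i, exists k, i = (2 * k)%nat \/ i = (2 * k + 1)%nat).
{ intros i; destruct (Nat.Even_or_Odd i) as [[k ->]|[k ->]]; exists k; auto. }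
assert (Hs : forall i, s i <> 0).
{ intros i; destruct (par i) as [k [-> | ->]]; rewrite ?s0, ?s1; [apply HPn|].
  intros E; apply (HPn (k + 1)%nat).
  replace (P ^ (k + 1)) with (P ^ (k + 1) / a * a) by (now field).
  rewrite E; ring. }
assert (d0 : forall j, s (2 * j)%nat * (x (2 * j)%nat - (b + c))
               = (1 - b * P ^ j) * (1 - c * P ^ j)).
{ intros j; rewrite s0, x0, Ea; field; apply HPn. }
assert (d1 : forall j, s (2 * j + 1)%nat * (x (2 * j + 1)%nat - (b + c))
               = (1 - P ^ (j + 1) / b) * (1 - P ^ (j + 1) / c)).
{ intros j; rewrite s1, x1, Ea; field; auto. }
assert (HX : forall i, x i <> b + c).
{ intros i E.
  destruct (par i) as [k [Ei | Ei]]; rewrite Ei in E.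
  - apply (Cmult_neq_0 _ _ (Hb1 k) (Hc1 k)); rewrite <- d0, E; ring.
  - apply (Cmult_neq_0 _ _ (HbP k) (HcP k)); rewrite <- d1, E; ring. }
assert (x01 : forall k l, x (2 * k)%nat <> x (2 * l + 1)%nat).
{ intros k l; rewrite x0, x1; intros E.
  assert (E' : (1 - P ^ (k + l + 1)) * (P ^ (l + 1) - a * P ^ k) = 0).
  { transitivity ((/ P ^ k + a * P ^ k - (P ^ (l + 1) + a / P ^ (l + 1)))
                  * (P ^ k * P ^ (l + 1))).
    - replace (k + l + 1)%nat with (k + (l + 1))%nat by lia.
      rewrite Cpow_add_r; field; auto.
    - rewrite E; ring. }
  revert E'; apply Cmult_neq_0.
  - apply Cminus_neq_0, not_eq_sym, H1.
  - apply Cminus_neq_0; intros E'.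
    (* The equation would make [a] a power of [P]: of nonpositive exponent if [l < k], against
       [Ha1], and of positive exponent otherwise, against [HaP]. *)
    destruct (Nat.lt_ge_cases l k) as [h|h].
    + apply (Ha1 (k - l - 1)%nat).
      assert (Ek : P ^ k = P ^ (l + 1) * P ^ (k - l - 1))
        by (rewrite <- Cpow_add_r; f_equal; lia).
      rewrite Ek in E'.
      transitivity (a * (P ^ (l + 1) * P ^ (k - l - 1)) / P ^ (l + 1));
        [field; auto|rewrite <- E'; field; auto].
    + apply (HaP (l - k)%nat).
      assert (El : P ^ (l + 1) = P ^ k * P ^ (l - k + 1))
        by (rewrite <- Cpow_add_r; f_equal; lia).
      rewrite El in E'.
      transitivity (P ^ k * P ^ (l - k + 1) / P ^ k);
        [field; auto|rewrite E'; field; auto]. }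
assert (Hx : forall i j, i <> j -> x i <> x j).
{ intros i j; destruct (par i) as [k Hi], (par j) as [l Hj].
  destruct Hi as [-> | ->], Hj as [-> | ->]; intros h.
  - assert (kl : P ^ l <> P ^ k) by (apply Cpow_inj; auto; lia).
    rewrite !x0; intros E.
    apply (Cmult_neq_0 (P ^ l - P ^ k) (1 - a * P ^ (k + l))).
    + now apply Cminus_neq_0.
    + now apply Cminus_neq_0, not_eq_sym.
    + transitivity ((/ P ^ k + a * P ^ k - (/ P ^ l + a * P ^ l))
                    * (P ^ k * P ^ l)).
      * rewrite Cpow_add_r; field; auto.
      * rewrite E; ring.
  - apply x01.
  - apply not_eq_sym, x01.
  - assert (kl : P ^ (k + 1) <> P ^ (l + 1)) by (apply Cpow_inj; auto; lia).
    rewrite !x1; intros E.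
    apply (Cmult_neq_0 (P ^ (k + 1) - P ^ (l + 1)) (P ^ (k + l + 1 + 1) - a)).
    + now apply Cminus_neq_0.
    + apply Cminus_neq_0, HaP.
    + transitivity ((P ^ (k + 1) + a / P ^ (k + 1)
                     - (P ^ (l + 1) + a / P ^ (l + 1)))
                    * (P ^ (k + 1) * P ^ (l + 1))).
      * replace (k + l + 1 + 1)%nat with (k + 1 + (l + 1))%nat by lia.
        rewrite (Cpow_add_r P (k + 1)); field; auto.
      * rewrite E; ring. }
assert (Main := partial_fractions s x (2 * N + 1) Hs
  (fun i j _ _ h => Hx i j h) (b + c) (fun i _ => HX i)).
replace (S (2 * N + 1)) with (2 * S N)%nat in Main by lia.
rewrite csum_double, cprod_double in Main.
rewrite (cprod_ext _ (fun j => (1 - b * P ^ j) * (1 - c * P ^ j)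
        * ((1 - P ^ (j + 1) / b) * (1 - P ^ (j + 1) / c)))) in Main
  by (intros j _; now rewrite d0, d1).
rewrite <- Main; apply csum_ext; intros j hj.
rewrite d0, d1, !cprod_double.
assert (q0 : forall z n, (forall k, 1 - z * P ^ k <> 0) -> qpoch z P n <> 0).
{ intros z n H; rewrite qpoch_cprod; apply cprod_neq_0; auto. }
assert (qP : forall n, qpoch P P n <> 0).
{ intros n; apply q0; intros k; apply Cminus_neq_0, not_eq_sym.
  rewrite <- Cpow_S, <- Nat.add_1_r; apply H1. }
assert (qa : forall n, qpoch a P n <> 0).
{ intros n; apply q0; intros k; now apply Cminus_neq_0, not_eq_sym. }
assert (EPa : P / a' = a / P).
{ rewrite Ea', <- Ea; field; auto. }
assert (nza : forall k, 1 - P ^ (k + 1) / a <> 0).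
{ intros k E; apply (HaP k).
  transitivity (a * (1 - (1 - P ^ (k + 1) / a))); [now field|rewrite E; ring]. }
assert (qPa : forall n, qpoch (P / a) P n <> 0).
{ intros n; apply q0; intros k.
  replace (P / a * P ^ k) with (P ^ (k + 1) / a); [apply nza|].
  rewrite Nat.add_1_r, Cpow_S; now field. }
assert (nza' : forall k, 1 - a' * P ^ k <> 0).
{ intros k; replace (a' * P ^ k) with (P ^ (k + 1 + 1) / a); [apply nza|].
  rewrite !Cpow_add_r, Cpow_1_r, Ea', <- Ea; now field. }
assert (qa' : forall n, qpoch a' P n <> 0) by (intros n; now apply q0).
assert (qPa' : forall n, qpoch (P / a') P n <> 0).
{ intros n; apply q0; intros [|k]; rewrite EPa.
  - intros E; apply (HaP O).
    rewrite Cpow_1_r.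
    transitivity (P * (1 - (1 - a / P * P ^ 0))).
    + rewrite E; ring.
    + change (P ^ 0) with (RtoC 1); now field.
  - replace (a / P * P ^ S k) with (a * P ^ k)
      by (rewrite Cpow_S; now field).
    now apply Cminus_neq_0, not_eq_sym. }
assert (np : forall z : C, z <> 0 -> 1 - z * P ^ (2 * j) <> 0 ->
  cprod (fun n =>
    (if Nat.eqb n j then 1 else (1 - P ^ n / P ^ j) * (1 - z * P ^ (n + j)))
    * ((1 - P ^ (n + j + 1)) * (1 - P ^ (n + 1) / (P ^ j * z)))) (S N)
  = qpoch P P (N - j) * qpoch P P (N + j + 1) * qpoch z P (N + j + 1)
    * qpoch (P / z) P (N - j + 1)
    / (P ^ (j * j) * z ^ j * (1 - z * P ^ (2 * j)))).
{ intros z Hz Hzj; assert (E := node_product P z j (N - j) HP Hz Hzj).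
  replace (j + 1 + (N - j))%nat with (S N) in E by lia.
  replace (N - j + 2 * j + 1)%nat with (N + j + 1)%nat in E by lia.
  exact E. }
assert (nz1 : 1 - a * P ^ (2 * j) <> 0) by now apply Cminus_neq_0, not_eq_sym.
f_equal.
- match goal with |- _ = / (_ * ?p) => replace p with
   (qpoch P P (N - j) * qpoch P P (N + j + 1) * qpoch a P (N + j + 1)
    * qpoch (P / a) P (N - j + 1)
    / (P ^ (j * j) * a ^ j * (1 - a * P ^ (2 * j)))) end.
  + field; repeat split; auto using Cpow_nz.
  + rewrite <- np by assumption; apply cprod_ext; intros n _.
    f_equal.
    * destruct (Nat.eqb_spec n j) as [e|e].
      { subst n; now rewrite Nat.eqb_refl. }
      destruct (Nat.eqb_spec (2 * n) (2 * j)) as [e'|_]; [lia|].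
      rewrite s0, !x0, Cpow_add_r; field; auto.
    * destruct (Nat.eqb_spec (2 * n + 1) (2 * j)) as [e'|_]; [lia|].
      rewrite s1, x1, x0, !Cpow_add_r, Cpow_1_r; field; auto.
- match goal with |- _ = / (_ * ?p) => replace p with
   (qpoch P P (N - j) * qpoch P P (N + j + 1) * qpoch a' P (N + j + 1)
    * qpoch (P / a') P (N - j + 1)
    / (P ^ (j * j) * a' ^ j * (1 - a' * P ^ (2 * j)))) end.
  + assert (u := HbP j); assert (v := HcP j).
    generalize dependent (1 - P ^ (j + 1) / b).
    generalize dependent (1 - P ^ (j + 1) / c).
    intros; field; repeat split; auto using Cpow_nz.
  + rewrite <- np by auto; apply cprod_ext; intros n _.
    (* Seen from the node [-j-1], it is the odd index that gives [(1 - P^(n-j))(1 - a' P^(n+j))], so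
       the two factors of each pair trade places. *)
    rewrite Cmult_comm; f_equal.
    * destruct (Nat.eqb_spec (2 * n) (2 * j + 1)) as [e'|_]; [lia|].
      rewrite s0, x1, x0, Ea', <- Ea, !Cpow_add_r, Cpow_1_r; field; auto.
    * destruct (Nat.eqb_spec n j) as [e|e].
      { subst n; now rewrite Nat.eqb_refl. }
      destruct (Nat.eqb_spec (2 * n + 1) (2 * j + 1)) as [e'|_]; [lia|].
      rewrite s1, !x1, Ea', <- Ea, !Cpow_add_r, Cpow_1_r; field; auto.
Qed.

(** * Pairing the terms of the series *)

Lemma Cpow_neq_1 (q : C) (n : nat) : (Cmod q < 1)%R -> q ^ (n + 1) <> 1.
Proof.
intros hq E; apply (f_equal Cmod) in E.
rewrite Cmod_Cpow, Cmod_1, Nat.add_1_r in E.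
assert (H := Cmod_ge_0 q).
assert (H' := pow_lt_1_compat (Cmod q) (S n) ltac:(lra) ltac:(lia)).
lra.
Qed.

Lemma one_minus_Cpow_neq_0 (q : C) (n : nat) :
  (Cmod q < 1)%R -> (0 < n)%nat -> 1 - q ^ n <> 0.
Proof.
intros hq hn; apply Cminus_neq_0, not_eq_sym.
replace n with (n - 1 + 1)%nat by lia; now apply Cpow_neq_1.
Qed.

Definition lambert_term (q : C) (k : nat) : C :=
  (- (1)) ^ k * q ^ (k * (k + 3) / 2) / (1 - q ^ (2 * k + 1)).

(** Replaces the integer quotient by an explicit exponent, a polynomial in [j] once [k] is [4j] plus
    a constant. *)
Lemma lambert_term_exponent (q : C) (k e : nat) : (k * (k + 3) = e * 2)%nat ->
  lambert_term q k = (- (1)) ^ k * q ^ e / (1 - q ^ (2 * k + 1)).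
Proof.
intros H; unfold lambert_term; now rewrite H, Nat.div_mul.
Qed.

Lemma Cpow_m1_4 (j : nat) : (- (1)) ^ (4 * j) = 1.
Proof.
rewrite Cpow_mult_r; replace ((- (1)) ^ 4) with (RtoC 1) by ring.
apply Cpow_1_l.
Qed.

(** With [u = q^(8j+1)] and [v = q^(8j+5)], the second exponent exceeds the first by exactly that of
    [v], and [1/(1-u) + v/(1-v) = (1-uv)/((1-u)(1-v))]. *)
Lemma lambert_term_even (q : C) (j : nat) : (Cmod q < 1)%R ->
  lambert_term q (4 * j) + lambert_term q (4 * j + 2)
  = (q ^ 8) ^ (j * j) * (q ^ 6) ^ j * (1 - q ^ 6 * (q ^ 8) ^ (2 * j))
    / ((1 - q ^ 5 * (q ^ 8) ^ j) * (1 - q * (q ^ 8) ^ j)).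
Proof.
intros hq.
rewrite (lambert_term_exponent q (4 * j) (8 * (j * j) + 6 * j)) by nia.
rewrite (lambert_term_exponent q (4 * j + 2)
           (8 * (j * j) + 6 * j + 8 * j + 5)) by nia.
rewrite (Cpow_add_r (- (1))), Cpow_m1_4.
assert (h1 := one_minus_Cpow_neq_0 q (8 * j + 1) hq ltac:(lia)).
assert (h2 := one_minus_Cpow_neq_0 q (8 * j + 5) hq ltac:(lia)).
replace (2 * (4 * j) + 1)%nat with (8 * j + 1)%nat by lia.
replace (2 * (4 * j + 2) + 1)%nat with (8 * j + 5)%nat by lia.
rewrite (Nat.mul_comm 2 j), <- !Cpow_mult_r, (Nat.mul_assoc 8 j 2).
rewrite (Cpow_mult_r q (8 * j) 2).
rewrite !Cpow_add_r in *; rewrite Cpow_1_r in *.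
field; split.
- intros E; apply h1; rewrite <- E; ring.
- intros E; apply h2; rewrite <- E; ring.
Qed.

(** The same identity with [u = q^(8j+3)] and [v = q^(8j+7)], written with [a' = P^2/a = q^10]. The
    prefactor [-q^2] is absorbed into [odd_weight]. *)
Lemma lambert_term_odd (q : C) (j : nat) : q <> 0 -> (Cmod q < 1)%R ->
  lambert_term q (4 * j + 1) + lambert_term q (4 * j + 3)
  = - q ^ 2 * ((q ^ 8) ^ (j * j) * (q ^ 10) ^ j
      * (1 - q ^ 10 * (q ^ 8) ^ (2 * j))
      / ((1 - (q ^ 8) ^ (j + 1) / q ^ 5) * (1 - (q ^ 8) ^ (j + 1) / q))).
Proof.
intros q0 hq.
rewrite (lambert_term_exponent q (4 * j + 1) (8 * (j * j) + 10 * j + 2)) by nia.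
rewrite (lambert_term_exponent q (4 * j + 3)
           (8 * (j * j) + 10 * j + 8 * j + 9)) by nia.
rewrite !(Cpow_add_r (- (1))), Cpow_m1_4.
assert (h1 := one_minus_Cpow_neq_0 q (8 * j + 3) hq ltac:(lia)).
assert (h2 := one_minus_Cpow_neq_0 q (8 * j + 7) hq ltac:(lia)).
replace (2 * (4 * j + 1) + 1)%nat with (8 * j + 3)%nat by lia.
replace (2 * (4 * j + 3) + 1)%nat with (8 * j + 7)%nat by lia.
replace ((q ^ 8) ^ (j + 1) / q ^ 5) with (q ^ (8 * j) * q ^ 3)
  by (rewrite Cpow_add_r, Cpow_1_r, <- Cpow_mult_r; field; assumption).
replace ((q ^ 8) ^ (j + 1) / q) with (q ^ (8 * j) * q ^ 7)
  by (rewrite Cpow_add_r, Cpow_1_r, <- Cpow_mult_r; field; assumption).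
rewrite (Nat.mul_comm 2 j), <- !Cpow_mult_r, (Nat.mul_assoc 8 j 2).
rewrite (Cpow_mult_r q (8 * j) 2).
rewrite !Cpow_add_r in *.
field; split; assumption.
Qed.

(** * The finite form of the identity *)

Lemma qpoch_shift (a q : C) (n : nat) :
  qpoch a q (S n) = (1 - a) * qpoch (a * q) q n.
Proof.
rewrite !qpoch_cprod, cprod_shift; f_equal.
- change (q ^ 0) with (RtoC 1); ring.
- apply cprod_ext; intros i _; rewrite Cpow_S; ring.
Qed.

Lemma qpoch_neq_0 (q : C) (s t n : nat) : (Cmod q < 1)%R -> (0 < s)%nat ->
  qpoch (q ^ s) (q ^ t) n <> 0.
Proof.
intros hq hs; rewrite qpoch_cprod; apply cprod_neq_0; intros i _.
rewrite <- Cpow_mult_r, <- Cpow_add_r.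
apply one_minus_Cpow_neq_0; [exact hq|lia].
Qed.

Definition even_weight (q : C) (N j : nat) : C :=
  / (qpoch (q ^ 8) (q ^ 8) (N - j) * qpoch (q ^ 8) (q ^ 8) (N + j + 1)
     * qpoch (q ^ 6) (q ^ 8) (N + j + 1) * qpoch (q ^ 2) (q ^ 8) (N - j + 1)).

(** The expansion gives the node [-j-1] the factors [(q^10;P)] and [(q^-2;P)], of lengths [N+j+1]
    and [N-j+1]. Moving their first factors by [1 - q^-2 = -q^-2 (1 - q^2)] yields [(q^2;P)] and
    [(q^6;P)], of lengths [N+j+2] and [N-j], times [-q^-2], which cancels the [-q^2] of
    [lambert_term_odd]. Both kinds of weight thus have visibly the same limit. *)
Definition odd_weight (q : C) (N j : nat) : C :=
  / (qpoch (q ^ 8) (q ^ 8) (N - j) * qpoch (q ^ 8) (q ^ 8) (N + j + 1)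
     * qpoch (q ^ 6) (q ^ 8) (N - j) * qpoch (q ^ 2) (q ^ 8) (N + j + 2)).

(** The expansion at [P = q^8], [b = q^5], [c = q]. On the right, the exponents [8j+1], [8j+3],
    [8j+5], [8j+7] for [j <= N] run through the odd numbers below [8(N+1)]. *)
Lemma finite_lambert_sum (q : C) (N : nat) : q <> 0 -> (Cmod q < 1)%R ->
  csum (fun j =>
      even_weight q N j * (lambert_term q (4 * j) + lambert_term q (4 * j + 2))
    + odd_weight q N j
      * (lambert_term q (4 * j + 1) + lambert_term q (4 * j + 3))) (S N)
  = / qpoch q (q ^ 2) (4 * S N).
Proof.
intros q0 hq.
assert (qn : forall n, q ^ n <> 0) by (intros n; now apply Cpow_nz).
assert (n1 : forall s t n, (0 < s)%nat -> 1 - q ^ s * (q ^ t) ^ n <> 0).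
{ intros s t n hs; rewrite <- Cpow_mult_r, <- Cpow_add_r.
  apply one_minus_Cpow_neq_0; [exact hq|lia]. }
assert (B := bilateral_partial_fractions (q ^ 8) (q ^ 6) (q ^ 10) (q ^ 5) q N).
transitivity (/ cprod (fun j => (1 - q ^ 5 * (q ^ 8) ^ j) * (1 - q * (q ^ 8) ^ j)
  * ((1 - (q ^ 8) ^ (j + 1) / q ^ 5) * (1 - (q ^ 8) ^ (j + 1) / q))) (S N)).
- rewrite <- B; clear B; auto.
  + apply csum_ext; intros j hj; f_equal.
    * rewrite lambert_term_even by exact hq; unfold even_weight.
      replace (q ^ 8 / q ^ 6) with (q ^ 2) by (field; assumption).
      unfold Cdiv; ring.
    * rewrite lambert_term_odd by assumption; unfold odd_weight.
      assert (E : qpoch (q ^ 10) (q ^ 8) (N + j + 1)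
                  * qpoch (q ^ 8 / q ^ 10) (q ^ 8) (N - j + 1)
                = - / q ^ 2 * (qpoch (q ^ 6) (q ^ 8) (N - j)
                               * qpoch (q ^ 2) (q ^ 8) (N + j + 2))).
      { replace (N - j + 1)%nat with (S (N - j)) by lia.
        replace (N + j + 2)%nat with (S (N + j + 1)) by lia.
        rewrite !qpoch_shift.
        replace (q ^ 8 / q ^ 10 * q ^ 8) with (q ^ 6) by (field; assumption).
        replace (q ^ 2 * q ^ 8) with (q ^ 10) by ring.
        field; assumption. }
      rewrite <- !(Cmult_assoc (qpoch (q ^ 8) (q ^ 8) (N - j)
                              * qpoch (q ^ 8) (q ^ 8) (N + j + 1))).
      rewrite E.
      generalize (((1 - (q ^ 8) ^ (j + 1) / q ^ 5)
                   * (1 - (q ^ 8) ^ (j + 1) / q))).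
      intros z; unfold Cdiv; generalize (/ z); intros z'.
      field; repeat split; auto; apply qpoch_neq_0; auto; lia.
  + ring.
  + field; auto.
  + intros n; rewrite <- Cpow_mult_r.
    replace (8 * (n + 1))%nat with (8 * n + 7 + 1)%nat by lia.
    now apply Cpow_neq_1.
  + intros n E; apply (n1 6%nat 8%nat n); [lia|rewrite E; ring].
  + intros n; rewrite <- Cpow_mult_r; apply Cpow_inj; auto; [|lia].
    intros m; now apply Cpow_neq_1.
  + intros n; apply n1; lia.
  + intros n; rewrite <- (Cpow_1_r q) at 1; apply n1; lia.
  + intros n; replace ((q ^ 8) ^ (n + 1) / q ^ 5) with (q ^ 3 * (q ^ 8) ^ n).
    * apply n1; lia.
    * rewrite Cpow_add_r, Cpow_1_r; field; assumption.
  + intros n; replace ((q ^ 8) ^ (n + 1) / q) with (q ^ 7 * (q ^ 8) ^ n).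
    * apply n1; lia.
    * rewrite Cpow_add_r, Cpow_1_r; field; assumption.
- f_equal; rewrite qpoch_cprod.
  replace (4 * S N)%nat with (2 * (2 * S N))%nat by lia.
  rewrite !cprod_double; apply cprod_ext; intros j _.
  replace ((q ^ 8) ^ (j + 1) / q ^ 5) with (q ^ 3 * (q ^ 8) ^ j)
    by (rewrite Cpow_add_r, Cpow_1_r; field; assumption).
  replace ((q ^ 8) ^ (j + 1) / q) with (q ^ 7 * (q ^ 8) ^ j)
    by (rewrite Cpow_add_r, Cpow_1_r; field; assumption).
  replace ((q ^ 8) ^ j) with ((q ^ 2) ^ (2 * (2 * j)))
    by (rewrite <- !Cpow_mult_r; f_equal; lia).
  rewrite Nat.mul_add_distr_l, !Cpow_add_r.
  change (2 * 1)%nat with 2%nat; ring.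
Qed.

Lemma qpoch_quadrisect (q : C) (N : nat) :
  qpoch (q ^ 2) (q ^ 2) (4 * N)
  = qpoch (q ^ 2) (q ^ 8) N * qpoch (q ^ 4) (q ^ 8) N
    * qpoch (q ^ 6) (q ^ 8) N * qpoch (q ^ 8) (q ^ 8) N.
Proof.
rewrite !qpoch_cprod.
replace (4 * N)%nat with (2 * (2 * N))%nat by lia.
rewrite !cprod_double, <- !cprod_mult; apply cprod_ext; intros j _.
replace ((q ^ 8) ^ j) with ((q ^ 2) ^ (2 * (2 * j)))
  by (rewrite <- !Cpow_mult_r; f_equal; lia).
rewrite Nat.mul_add_distr_l, !Cpow_add_r.
change (2 * 1)%nat with 2%nat; ring.
Qed.

(** * Geometric rates of convergence for q-factorials and their inverses *)

Lemma filterlim_C_eps (u : nat -> C) (l : C) :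
  filterlim u eventually (locally l) <->
  (forall eps : posreal, exists N, forall n, (N <= n)%nat ->
     (Cmod (u n - l) < eps)%R).
Proof.
exact (filterlim_locally_ball_norm (K := C_AbsRing) (U := C_NormedModule)
         (F := eventually) u l).
Qed.

(** The index type is arbitrary so that one notion covers both sequences and the weights, indexed by
    pairs [(N, j)] with a constant uniform in [j]. *)
Definition rate {I : Type} (e : I -> R) (u : I -> C) (l : C) : Prop :=
  exists K, (0 <= K)%R /\ forall i, (Cmod (u i - l) <= K * e i)%R.

Lemma Cmod_minus_sym (a b : C) : Cmod (a - b) = Cmod (b - a).
Proof. rewrite <- Cmod_opp; f_equal; ring. Qed.

Lemma Cmod_minus_triangle (a b c : C) :
  (Cmod (a - c) <= Cmod (a - b) + Cmod (b - c))%R.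
Proof.
replace (a - c) with ((a - b) + (b - c)) by ring; apply Cmod_triangle.
Qed.

Lemma Cmod_le_minus (a b : C) : (Cmod a <= Cmod b + Cmod (a - b))%R.
Proof.
replace a with (b + (a - b)) at 1 by ring; apply Cmod_triangle.
Qed.

Lemma rate_comp {I J : Type} (e : I -> R) (e' : J -> R) (phi : J -> I)
  (u : I -> C) (l : C) :
  (forall j, (e (phi j) <= e' j)%R) -> rate e u l ->
  rate e' (fun j => u (phi j)) l.
Proof.
intros H [K [HK Hu]]; exists K; split; [exact HK|intros j].
eapply Rle_trans; [apply Hu|now apply Rmult_le_compat_l].
Qed.

Lemma rate_mult {I : Type} (e : I -> R) (u v : I -> C) (l m : C) :
  (forall i, (0 <= e i <= 1)%R) ->
  rate e u l -> rate e v m -> rate e (fun i => u i * v i) (l * m).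
Proof.
intros He [K [HK Hu]] [L [HL Hv]].
exists (K * (Cmod m + L) + Cmod l * L)%R; split.
{ assert (H1 := Cmod_ge_0 m); assert (H2 := Cmod_ge_0 l).
  apply Rplus_le_le_0_compat; apply Rmult_le_pos; lra. }
intros i.
replace (u i * v i - l * m) with ((u i - l) * v i + l * (v i - m)) by ring.
eapply Rle_trans; [apply Cmod_triangle|]; rewrite !Cmod_mult.
assert (H1 := Hu i); assert (H2 := Hv i); assert (H3 := He i).
assert (H4 := Cmod_le_minus (v i) m).
assert (H5 : (Cmod (v i) <= Cmod m + L)%R) by nra.
assert (H6 : (Cmod (u i - l) * Cmod (v i) <= K * e i * (Cmod m + L))%R)
  by (apply Rmult_le_compat; auto using Cmod_ge_0).
assert (H7 : (Cmod l * Cmod (v i - m) <= Cmod l * (L * e i))%R)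
  by (apply Rmult_le_compat_l; auto using Cmod_ge_0).
lra.
Qed.

Lemma rate_inv {I : Type} (e : I -> R) (u : I -> C) (l : C) (c : R) :
  (0 < c)%R -> (forall i, (c <= Cmod (u i))%R) -> (c <= Cmod l)%R ->
  rate e u l -> rate e (fun i => / u i) (/ l).
Proof.
intros Hc Hu Hl [K [HK H]].
assert (Hc2 : (0 < / (c * c))%R) by (apply Rinv_0_lt_compat; nra).
exists (K * / (c * c))%R; split; [apply Rmult_le_pos; lra|intros i].
assert (u0 : u i <> 0) by (apply Cmod_gt_0; specialize (Hu i); lra).
assert (l0 : l <> 0) by (apply Cmod_gt_0; lra).
replace (/ u i - / l) with ((l - u i) * / (u i * l)) by (field; auto).
rewrite Cmod_mult, Cmod_inv, Cmod_mult by (now apply Cmult_neq_0).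
rewrite Cmod_minus_sym.
replace (K * / (c * c) * e i)%R with (K * e i * / (c * c))%R by ring.
specialize (H i); specialize (Hu i).
apply Rmult_le_compat; auto using Cmod_ge_0.
- left; apply Rinv_0_lt_compat; nra.
- apply Rinv_le_contravar; nra.
Qed.

Lemma pow_le_eps (r K : R) (eps : posreal) : (0 <= r < 1)%R -> (0 <= K)%R ->
  exists N, forall n, (N <= n)%nat -> (K * r ^ n < eps)%R.
Proof.
intros Hr HK.
destruct (pow_lt_1_zero r ltac:(rewrite Rabs_pos_eq; lra) (eps / (K + 1)))
  as [N HN].
{ apply Rdiv_lt_0_compat; [apply cond_pos|lra]. }
exists N; intros n hn; specialize (HN n hn).
assert (h : (0 <= r ^ n)%R) by (apply pow_le; lra).
rewrite Rabs_pos_eq in HN by exact h.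
apply (Rmult_lt_compat_r (K + 1)) in HN; [|lra].
unfold Rdiv in HN; rewrite Rmult_assoc, Rinv_l, Rmult_1_r in HN by lra.
nra.
Qed.

Lemma rate_unique (r : R) (u : nat -> C) (l m : C) : (0 <= r < 1)%R ->
  rate (fun n => r ^ n)%R u l -> rate (fun n => r ^ n)%R u m -> l = m.
Proof.
intros Hr [K [HK Hu]] [L [HL Hv]].
assert (H : Cmod (l - m) = 0).
{ apply Rle_antisym; [|apply Cmod_ge_0].
  apply le_epsilon; intros e He.
  destruct (pow_le_eps r (K + L) (mkposreal e He) Hr ltac:(lra)) as [N HN].
  specialize (HN N (le_n N)); simpl in HN.
  assert (T := Cmod_minus_triangle l (u N) m).
  rewrite (Cmod_minus_sym l (u N)) in T; specialize (Hu N); specialize (Hv N); lra. }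
apply Cmod_eq_0 in H.
replace l with (l - m + m) by ring; rewrite H; ring.
Qed.

(** Consecutive differences are at most [K |q|^n] by [qpoch_bound]. Telescoping bounds the distance
    to any later term by a geometric sum, and the later index is then sent to infinity. *)
Lemma qpoch_rate (a q : C) : (Cmod q < 1)%R ->
  rate (fun n => Cmod q ^ n)%R (qpoch a q) (qpoch_inf a q).
Proof.
intros hq; assert (q0 := Cmod_ge_0 q); assert (a0 := Cmod_ge_0 a).
set (K := (exp (Cmod a / (1 - Cmod q)) * Cmod a)%R).
assert (HK : (0 <= K)%R)
  by (apply Rmult_le_pos; [left; apply exp_pos|exact a0]).
assert (Hpow : forall m, (0 <= Cmod q ^ m)%R) by (intros m; now apply pow_le).
assert (Hi : (0 < / (1 - Cmod q))%R) by (apply Rinv_0_lt_compat; lra).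
assert (Hd : forall n d, (Cmod (qpoch a q (n + d) - qpoch a q n)
   <= K * (Cmod q ^ n - Cmod q ^ (n + d)) / (1 - Cmod q))%R).
{ intros n d; induction d as [|d IH].
  - rewrite Nat.add_0_r; unfold Cminus; rewrite Cplus_opp_r, Cmod_0; right.
    field; lra.
  - rewrite Nat.add_succ_r.
    eapply Rle_trans; [apply (Cmod_minus_triangle _ (qpoch a q (n + d)))|].
    assert (Hs : (Cmod (qpoch a q (S (n + d)) - qpoch a q (n + d))
                  <= K * Cmod q ^ (n + d))%R).
    { simpl qpoch.
      match goal with |- (Cmod ?z <= _)%R =>
        replace z with (- (qpoch a q (n + d) * a * q ^ (n + d))) by ring end.
      rewrite Cmod_opp, !Cmod_mult, Cmod_Cpow.
      apply Rmult_le_compat_r; [apply Hpow|].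
      apply Rmult_le_compat_r; [exact a0|now apply qpoch_bound]. }
    replace (K * (Cmod q ^ n - Cmod q ^ S (n + d)) / (1 - Cmod q))%R with
      (K * Cmod q ^ (n + d)
       + K * (Cmod q ^ n - Cmod q ^ (n + d)) / (1 - Cmod q))%R
      by (simpl; field; lra).
    lra. }
exists (K / (1 - Cmod q))%R; split; [apply Rmult_le_pos; lra|intros n].
apply le_epsilon; intros e He.
destruct (proj1 (filterlim_C_eps _ _) (qpoch_inf_correct a q hq)
            (mkposreal e He)) as [N HN].
specialize (HN (n + N)%nat ltac:(lia)); simpl in HN.
eapply Rle_trans; [apply (Cmod_minus_triangle _ (qpoch a q (n + N)))|].
rewrite Cmod_minus_sym; specialize (Hd n N).
assert (h : (K * (Cmod q ^ n - Cmod q ^ (n + N)) / (1 - Cmod q)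
             <= K / (1 - Cmod q) * Cmod q ^ n)%R).
{ unfold Rdiv; rewrite (Rmult_assoc K _ (Cmod q ^ n)).
  rewrite (Rmult_assoc K).
  apply Rmult_le_compat_l; [exact HK|]; rewrite Rmult_comm.
  apply Rmult_le_compat_l; [lra|]; specialize (Hpow (n + N)%nat); lra. }
lra.
Qed.

(** With [x = |a| |q|^n <= |a|], each factor has modulus at least [1 - x >= 1/(1 + x/(1-|a|)) >=
    exp(-x/(1-|a|))]. The exponents sum to at most [b], so [exp (- b)] is a bound uniform in the
    length, which survives in the limit. *)
Lemma qpoch_lower_bound (a q : C) : (Cmod a < 1)%R -> (Cmod q < 1)%R ->
  exists c, (0 < c)%R /\ (forall n, (c <= Cmod (qpoch a q n))%R)
    /\ (c <= Cmod (qpoch_inf a q))%R.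
Proof.
intros ha hq; assert (q0 := Cmod_ge_0 q); assert (a0 := Cmod_ge_0 a).
set (b := (Cmod a / ((1 - Cmod a) * (1 - Cmod q)))%R).
assert (Hb : (0 <= b)%R).
{ apply Rmult_le_pos; [exact a0|left; apply Rinv_0_lt_compat; nra]. }
assert (Hp : forall m, (0 <= Cmod q ^ m <= 1)%R).
{ intros m; split; [now apply pow_le|].
  rewrite <- (pow1 m); apply pow_incr; lra. }
assert (H : forall n, (exp (- (b * (1 - Cmod q ^ n))) <= Cmod (qpoch a q n))%R).
{ induction n as [|n IH].
  - simpl; rewrite Cmod_1, Rminus_diag, Rmult_0_r, Ropp_0, exp_0; lra.
  - simpl qpoch; rewrite Cmod_mult.
    set (x := (Cmod a * Cmod q ^ n)%R).
    replace (- (b * (1 - Cmod q ^ S n)))%R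
      with (- (b * (1 - Cmod q ^ n)) + - (x / (1 - Cmod a)))%R
      by (unfold b, x; simpl; field; lra).
    rewrite exp_plus.
    apply Rmult_le_compat; try (left; apply exp_pos); [exact IH|].
    assert (Hx : (0 <= x <= Cmod a)%R).
    { unfold x; specialize (Hp n); nra. }
    apply Rle_trans with (1 - x)%R.
    + rewrite exp_Ropp.
      apply Rle_trans with (/ (1 + x / (1 - Cmod a)))%R.
      * assert (0 <= x / (1 - Cmod a))%R.
        { apply Rmult_le_pos; [lra|left; apply Rinv_0_lt_compat; lra]. }
        apply Rinv_le_contravar; [lra|apply exp_ineq1_le].
      * replace (/ (1 + x / (1 - Cmod a)))%R
          with ((1 - Cmod a) / (1 - Cmod a + x))%R by (field; lra).
        apply (Rmult_le_reg_r (1 - Cmod a + x)); [lra|].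
        unfold Rdiv; rewrite Rmult_assoc, Rinv_l by lra; nra.
    + assert (T := Cmod_le_minus 1 (a * q ^ n)).
      rewrite Cmod_1, Cmod_mult, Cmod_Cpow in T; fold x in T; lra. }
assert (H' : forall n, (exp (- b) <= Cmod (qpoch a q n))%R).
{ intros n; eapply Rle_trans; [|apply H]; specialize (Hp n).
  destruct (Req_dec (- b) (- (b * (1 - Cmod q ^ n)))) as [<-|h]; [lra|].
  left; apply exp_increasing; nra. }
exists (exp (- b)); split; [apply exp_pos|split; [exact H'|]].
apply le_epsilon; intros e He.
destruct (proj1 (filterlim_C_eps _ _) (qpoch_inf_correct a q hq)
            (mkposreal e He)) as [N HN].
specialize (HN N (le_n N)); simpl in HN.
assert (T := Cmod_le_minus (qpoch a q N) (qpoch_inf a q)).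
specialize (H' N); lra.
Qed.

Lemma Cmod_pow_lt_1 (q : C) (s : nat) : (Cmod q < 1)%R -> (0 < s)%nat ->
  (Cmod (q ^ s) < 1)%R.
Proof.
intros hq hs; rewrite Cmod_Cpow.
apply pow_lt_1_compat; [split; [apply Cmod_ge_0|exact hq]|exact hs].
Qed.

Lemma pow_le_pow (r : R) (m n : nat) : (0 <= r <= 1)%R -> (m <= n)%nat ->
  (r ^ n <= r ^ m)%R.
Proof.
intros Hr h; replace n with (m + (n - m))%nat by lia; rewrite pow_add.
assert (h1 := pow_le r m (proj1 Hr)); assert (h2 := pow_le r (n - m) (proj1 Hr)).
assert (h3 : (r ^ (n - m) <= 1)%R)
  by (rewrite <- (pow1 (n - m)); apply pow_incr; lra).
nra.
Qed.

Lemma qpoch_pow_rate {I : Type} (q : C) (s t : nat) (m : I -> nat)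
  (phi : I -> nat) :
  (Cmod q < 1)%R -> (0 < t)%nat -> (forall i, (m i <= t * phi i)%nat) ->
  rate (fun i => Cmod q ^ m i)%R (fun i => qpoch (q ^ s) (q ^ t) (phi i))
    (qpoch_inf (q ^ s) (q ^ t)).
Proof.
intros hq ht Hm.
refine (rate_comp _ _ phi (qpoch (q ^ s) (q ^ t)) _ _ (qpoch_rate _ _ _)).
- intros i; rewrite Cmod_Cpow, <- pow_mult.
  apply pow_le_pow; [split; [apply Cmod_ge_0|lra]|apply Hm].
- now apply Cmod_pow_lt_1.
Qed.

Lemma inv_qpoch_pow_rate {I : Type} (q : C) (s t : nat) (m : I -> nat)
  (phi : I -> nat) :
  (Cmod q < 1)%R -> (0 < s)%nat -> (0 < t)%nat ->
  (forall i, (m i <= t * phi i)%nat) ->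
  rate (fun i => Cmod q ^ m i)%R (fun i => / qpoch (q ^ s) (q ^ t) (phi i))
    (/ qpoch_inf (q ^ s) (q ^ t)).
Proof.
intros hq hs ht Hm.
destruct (qpoch_lower_bound (q ^ s) (q ^ t)) as [c [Hc [Hn Hl]]];
  try now apply Cmod_pow_lt_1.
apply (rate_inv _ _ _ c); auto.
now apply qpoch_pow_rate.
Qed.

Lemma qpoch_inf_neq_0 (q : C) (s t : nat) :
  (Cmod q < 1)%R -> (0 < s)%nat -> (0 < t)%nat ->
  qpoch_inf (q ^ s) (q ^ t) <> 0.
Proof.
intros hq hs ht.
destruct (qpoch_lower_bound (q ^ s) (q ^ t)) as [c [Hc [_ Hl]]];
  try now apply Cmod_pow_lt_1.
apply Cmod_gt_0; lra.
Qed.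

(** Turns the [(q^2;q^8)] and [(q^6;q^8)] of the weight limit into the [(q^2;q^2)] and [(q^4;q^8)]
    of the closed form. Both sides are limits of the finite splitting of the exponents by residue
    modulo 8. *)
Lemma qpoch_inf_quadrisect (q : C) : (Cmod q < 1)%R ->
  qpoch_inf (q ^ 2) (q ^ 2)
  = qpoch_inf (q ^ 2) (q ^ 8) * qpoch_inf (q ^ 4) (q ^ 8)
    * qpoch_inf (q ^ 6) (q ^ 8) * qpoch_inf (q ^ 8) (q ^ 8).
Proof.
intros hq.
assert (Hr : (0 <= Cmod q < 1)%R) by (split; [apply Cmod_ge_0|exact hq]).
assert (He : forall n, (0 <= Cmod q ^ n <= 1)%R).
{ intros n; split; [now apply pow_le|].
  rewrite <- (pow1 n); apply pow_incr; lra. }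
apply (rate_unique (Cmod q) (fun N => qpoch (q ^ 2) (q ^ 2) (4 * N)) _ _ Hr).
- apply (qpoch_pow_rate q 2 2 (fun n => n) (fun n => 4 * n)%nat); auto; lia.
- assert (R : forall t, rate (fun n => Cmod q ^ n)%R (qpoch (q ^ t) (q ^ 8))
                          (qpoch_inf (q ^ t) (q ^ 8))).
  { intros t; apply (qpoch_pow_rate q t 8 (fun n => n) (fun n => n));
      auto; lia. }
  destruct (rate_mult _ _ _ _ _ He (rate_mult _ _ _ _ _ He
    (rate_mult _ _ _ _ _ He (R 2%nat) (R 4%nat)) (R 6%nat)) (R 8%nat))
    as [K [HK H]].
  exists K; split; [exact HK|intros n; rewrite qpoch_quadrisect; apply H].
Qed.

(** * Passing to the limit in the finite identity *)

Definition weight_lim (q : C) : C :=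
  / qpoch_inf (q ^ 8) (q ^ 8) * / qpoch_inf (q ^ 8) (q ^ 8)
  * / qpoch_inf (q ^ 6) (q ^ 8) * / qpoch_inf (q ^ 2) (q ^ 8).

(** Here [i = (N, j)]. The four lengths are left free so that the lemma applies to [even_weight] and
    to [odd_weight]; being at least [N - j] is what gives the rate. *)
Lemma weight_rate (q : C) (m1 m2 m3 m4 : nat * nat -> nat) : (Cmod q < 1)%R ->
  (forall i, (fst i - snd i <= m1 i /\ fst i - snd i <= m2 i
              /\ fst i - snd i <= m3 i /\ fst i - snd i <= m4 i)%nat) ->
  rate (fun i => Cmod q ^ (fst i - snd i))%R
    (fun i => / (qpoch (q ^ 8) (q ^ 8) (m1 i) * qpoch (q ^ 8) (q ^ 8) (m2 i)
                 * qpoch (q ^ 6) (q ^ 8) (m3 i) * qpoch (q ^ 2) (q ^ 8) (m4 i)))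
    (weight_lim q).
Proof.
intros hq Hm.
assert (He : forall i : nat * nat, (0 <= Cmod q ^ (fst i - snd i) <= 1)%R).
{ intros i; split; [apply pow_le, Cmod_ge_0|].
  rewrite <- (pow1 (fst i - snd i)); apply pow_incr.
  split; [apply Cmod_ge_0|lra]. }
assert (R : forall s m, (0 < s)%nat ->
  (forall i, fst i - snd i <= m i)%nat ->
  rate (fun i : nat * nat => Cmod q ^ (fst i - snd i))%R
    (fun i => / qpoch (q ^ s) (q ^ 8) (m i)) (/ qpoch_inf (q ^ s) (q ^ 8))).
{ intros s m hs h.
  apply (inv_qpoch_pow_rate q s 8 (fun i => fst i - snd i)%nat m); auto; try lia.
  intros i; specialize (h i); lia. }
destruct (rate_mult _ _ _ _ _ He (rate_mult _ _ _ _ _ He (rate_mult _ _ _ _ _ He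
  (R 8%nat m1 ltac:(lia) ltac:(apply Hm)) (R 8%nat m2 ltac:(lia) ltac:(apply Hm)))
  (R 6%nat m3 ltac:(lia) ltac:(apply Hm))) (R 2%nat m4 ltac:(lia) ltac:(apply Hm)))
  as [K [HK H]].
exists K; split; [exact HK|intros i].
eapply Rle_trans; [|apply H]; right; unfold weight_lim; do 2 f_equal.
field; repeat split; apply qpoch_neq_0; auto; lia.
Qed.

Lemma csum_geom_bound (f : nat -> C) (A r : R) (n : nat) :
  (0 <= r < 1)%R -> (0 <= A)%R ->
  (forall j, (j < n)%nat -> (Cmod (f j) <= A * r ^ j)%R) ->
  (Cmod (csum f n) <= A / (1 - r))%R.
Proof.
intros Hr HA H.
apply Rle_trans with (A * (1 - r ^ n) / (1 - r))%R.
- induction n as [|n IH].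
  + simpl; rewrite Cmod_0; right; field; lra.
  + simpl csum; eapply Rle_trans; [apply Cmod_triangle|].
    replace (A * (1 - r ^ S n) / (1 - r))%R
      with (A * (1 - r ^ n) / (1 - r) + A * r ^ n)%R by (simpl; field; lra).
    apply Rplus_le_compat; [apply IH; auto with arith|apply H; lia].
- apply Rmult_le_compat_r; [left; apply Rinv_0_lt_compat; lra|].
  assert (h := pow_le r n (proj1 Hr)); nra.
Qed.

Lemma lambert_term_bound (q : C) (k : nat) : (Cmod q < 1)%R ->
  (Cmod (lambert_term q k) <= / (1 - Cmod q) * Cmod q ^ k)%R.
Proof.
intros hq; unfold lambert_term.
assert (Hr : (0 <= Cmod q <= 1)%R) by (split; [apply Cmod_ge_0|lra]).
rewrite Cmod_div by (apply one_minus_Cpow_neq_0; [exact hq|lia]).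
rewrite Cmod_mult, !Cmod_Cpow, Cmod_m1, pow1, Rmult_1_l.
unfold Rdiv; rewrite Rmult_comm.
apply Rmult_le_compat.
- left; apply Rinv_0_lt_compat, Cmod_gt_0.
  apply one_minus_Cpow_neq_0; [exact hq|lia].
- apply pow_le, Hr.
- apply Rinv_le_contravar; [lra|].
  assert (T := Cmod_le_minus 1 (q ^ (2 * k + 1))).
  rewrite Cmod_1, Cmod_Cpow in T.
  assert (h := pow_le_pow (Cmod q) 1 (2 * k + 1) Hr ltac:(lia)).
  rewrite pow_1 in h; lra.
- apply pow_le_pow; [exact Hr|].
  apply Nat.div_le_lower_bound; nia.
Qed.

(** In [finite_lambert_sum] every weight is replaced by the common limit [H]. With [r = |q|], the
    error at [j] is of order [r^(N-j)] from the weight times [r^(2j)] from the terms, that is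
    [r^N r^j], which sums over [j] to order [r^N]. *)
Lemma lambert_sum_rate (q : C) : q <> 0 -> (Cmod q < 1)%R ->
  rate (fun N => Cmod q ^ N)%R (fun N => csum (lambert_term q) (4 * S N))
    (/ weight_lim q * / qpoch_inf q (q ^ 2)).
Proof.
intros q0 hq.
assert (Hr : (0 <= Cmod q < 1)%R) by (split; [apply Cmod_ge_0|exact hq]).
set (r := Cmod q) in *; set (T := lambert_term q).
assert (Hi : (0 < / (1 - r))%R) by (apply Rinv_0_lt_compat; lra).
destruct (weight_rate q (fun i => fst i - snd i)%nat
  (fun i => fst i + snd i + 1)%nat (fun i => fst i + snd i + 1)%nat
  (fun i => fst i - snd i + 1)%nat hq) as [K1 [HK1 W1]].
{ intros i; repeat split; lia. }
destruct (weight_rate q (fun i => fst i - snd i)%nat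
  (fun i => fst i + snd i + 1)%nat (fun i => fst i - snd i)%nat
  (fun i => fst i + snd i + 2)%nat hq) as [K2 [HK2 W2]].
{ intros i; repeat split; lia. }
assert (R : rate (fun N => r ^ N)%R (fun N => / qpoch (q ^ 1) (q ^ 2) (4 * S N))
              (/ qpoch_inf (q ^ 1) (q ^ 2))).
{ apply (inv_qpoch_pow_rate q 1 2 (fun N => N) (fun N => 4 * S N)%nat);
    auto; lia. }
rewrite Cpow_1_r in R; destruct R as [K3 [HK3 R]].
fold r in W1, W2.
set (H := weight_lim q) in *.
assert (H0 : H <> 0).
{ unfold H, weight_lim.
  assert (h := fun s hs => qpoch_inf_neq_0 q s 8 hq hs ltac:(lia)).
  assert (i : forall z : C, z <> 0 -> / z <> 0).
  { intros z hz E; apply C1_nz; rewrite <- (Cinv_r z hz), E; ring. }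
  repeat apply Cmult_neq_0; apply i, h; lia. }
(* The 2 counts the terms of each pair, one [1/(1-r)] comes from [lambert_term_bound], and the other
   from the geometric sum over [j]. *)
set (B := (2 * (K1 + K2) * / (1 - r) / (1 - r))%R).
assert (HB : (0 <= B)%R) by (unfold B, Rdiv; repeat apply Rmult_le_pos; lra).
assert (HH : (0 <= Cmod (/ H))%R) by apply Cmod_ge_0.
exists (Cmod (/ H) * (K3 + B))%R; split; [apply Rmult_le_pos; lra|intros N].
set (err := csum (fun j =>
  (even_weight q N j - H) * (T (4 * j)%nat + T (4 * j + 2)%nat)
  + (odd_weight q N j - H) * (T (4 * j + 1)%nat + T (4 * j + 3)%nat)) (S N)).
assert (E : csum T (4 * S N) * H + err = / qpoch q (q ^ 2) (4 * S N)).
{ rewrite <- finite_lambert_sum by assumption; unfold err.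
  replace (4 * S N)%nat with (2 * (2 * S N))%nat by lia.
  rewrite !csum_double, Cmult_comm, <- csum_scal, <- csum_plus.
  apply csum_ext; intros j _; fold T.
  replace (2 * (2 * j))%nat with (4 * j)%nat by lia.
  replace (2 * (2 * j + 1))%nat with (4 * j + 2)%nat by lia.
  replace (4 * j + 2 + 1)%nat with (4 * j + 3)%nat by lia.
  ring. }
replace (csum T (4 * S N) - / H * / qpoch_inf q (q ^ 2))
  with (/ H * ((/ qpoch q (q ^ 2) (4 * S N) - / qpoch_inf q (q ^ 2)) - err)).
2:{ rewrite <- E.
    replace (/ H * (csum T (4 * S N) * H + err - / qpoch_inf q (q ^ 2) - err))
      with (/ H * H * csum T (4 * S N) - / H * / qpoch_inf q (q ^ 2)) by ring.
    rewrite Cinv_l by exact H0; ring. }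
rewrite Cmod_mult, Rmult_assoc; apply Rmult_le_compat_l; [exact HH|].
unfold Cminus at 1; eapply Rle_trans; [apply Cmod_triangle|].
rewrite Cmod_opp, Rmult_plus_distr_r; apply Rplus_le_compat; [apply R|].
replace (B * r ^ N)%R with (2 * (K1 + K2) * / (1 - r) * r ^ N / (1 - r))%R
  by (unfold B; field; lra).
assert (Hp : forall n, (0 <= r ^ n)%R) by (intros; now apply pow_le).
apply csum_geom_bound; [exact Hr| |].
{ repeat apply Rmult_le_pos; auto; lra. }
intros j hj.
(* The indices used are at least [4j], but [r^(2j)] already outweighs the loss of [r^(-j)] in
   [r^(N-j)]. *)
assert (Tb : forall k, (2 * j <= k)%nat -> (Cmod (T k) <= / (1 - r) * r ^ (2 * j))%R).
{ intros k hk; eapply Rle_trans; [now apply lambert_term_bound|].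
  apply Rmult_le_compat_l; [lra|apply pow_le_pow; [fold r; lra|exact hk]]. }
assert (Tb2 : forall k l, (2 * j <= k)%nat -> (2 * j <= l)%nat ->
  (Cmod (T k + T l) <= 2 * (/ (1 - r) * r ^ (2 * j)))%R).
{ intros k l hk hl; eapply Rle_trans; [apply Cmod_triangle|].
  assert (h1 := Tb k hk); assert (h2 := Tb l hl); lra. }
assert (w1 := W1 (N, j)); assert (w2 := W2 (N, j)); cbn [fst snd] in w1, w2.
fold (even_weight q N j) in w1; fold (odd_weight q N j) in w2.
eapply Rle_trans; [apply Cmod_triangle|]; rewrite !Cmod_mult.
assert (e1 : (Cmod (even_weight q N j - H) * Cmod (T (4 * j)%nat + T (4 * j + 2)%nat)
  <= K1 * r ^ (N - j) * (2 * (/ (1 - r) * r ^ (2 * j))))%R).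
{ apply Rmult_le_compat; auto using Cmod_ge_0; apply Tb2; lia. }
assert (e2 : (Cmod (odd_weight q N j - H)
    * Cmod (T (4 * j + 1)%nat + T (4 * j + 3)%nat)
  <= K2 * r ^ (N - j) * (2 * (/ (1 - r) * r ^ (2 * j))))%R).
{ apply Rmult_le_compat; auto using Cmod_ge_0; apply Tb2; lia. }
eapply Rle_trans; [apply Rplus_le_compat; [exact e1|exact e2]|]; right.
replace (r ^ N)%R with (r ^ (N - j) * r ^ j)%R
  by (rewrite <- pow_add; f_equal; lia).
replace (2 * j)%nat with (j + j)%nat by lia; rewrite pow_add; ring.
Qed.

(** * From blocks of four terms to the full series *)

Lemma sum_n_csum (f : nat -> C) (n : nat) :
  sum_n (G := C_AbelianMonoid) f n = csum f (S n).
Proof.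
induction n as [|n IH].
- rewrite sum_O; simpl; ring.
- rewrite sum_Sn, IH; reflexivity.
Qed.

(** [lambert_sum_rate] controls partial sums whose length is a multiple of 4. Any other length adds
    at most three terms, each bounded by [|q|^N / (1 - |q|)]. *)
Lemma lambert_series (q : C) : q <> 0 -> (Cmod q < 1)%R ->
  is_series (K := C_AbsRing) (V := C_NormedModule) (lambert_term q)
    (/ weight_lim q * / qpoch_inf q (q ^ 2)).
Proof.
intros q0 hq.
assert (Hr : (0 <= Cmod q < 1)%R) by (split; [apply Cmod_ge_0|exact hq]).
assert (Hi : (0 < / (1 - Cmod q))%R) by (apply Rinv_0_lt_compat; lra).
destruct (lambert_sum_rate q q0 hq) as [K [HK H]].
set (L := / weight_lim q * / qpoch_inf q (q ^ 2)) in *.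
assert (Hn : forall N d, (Cmod (csum (lambert_term q) (4 * S N + d) - L)
  <= (K + INR d * / (1 - Cmod q)) * Cmod q ^ N)%R).
{ intros N d; induction d as [|d IH].
  - rewrite Nat.add_0_r; simpl INR; specialize (H N); lra.
  - rewrite Nat.add_succ_r, S_INR; cbn [csum].
    replace (csum (lambert_term q) (4 * S N + d) + lambert_term q (4 * S N + d) - L)
      with ((csum (lambert_term q) (4 * S N + d) - L)
            + lambert_term q (4 * S N + d)) by ring.
    eapply Rle_trans; [apply Cmod_triangle|].
    assert (T : (Cmod (lambert_term q (4 * S N + d))
                 <= / (1 - Cmod q) * Cmod q ^ N)%R).
    { eapply Rle_trans; [now apply lambert_term_bound|].
      apply Rmult_le_compat_l; [lra|apply pow_le_pow; [lra|lia]]. }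
    lra. }
apply filterlim_C_eps; intros eps.
destruct (pow_le_eps (Cmod q) (K + 3 * / (1 - Cmod q)) eps Hr ltac:(lra))
  as [N HN].
exists (4 * S N)%nat; intros n hn; rewrite sum_n_csum.
(* The controlled lengths are [4 (M + 1)], hence the subtraction of 1; it does not truncate, since
   [hM] below gives a quotient of at least [N + 1]. *)
set (M := (S n / 4 - 1)%nat); set (d := (S n mod 4)%nat).
assert (En := Nat.div_mod_eq (S n) 4).
assert (hd : (d <= 3)%nat) by (assert (h := Nat.mod_upper_bound (S n) 4); lia).
assert (hM : (S N <= S n / 4)%nat) by (apply Nat.div_le_lower_bound; lia).
replace (S n) with (4 * S M + d)%nat by lia.
eapply Rle_lt_trans; [apply Hn|]; eapply Rle_lt_trans; [|apply (HN M); lia].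
apply Rmult_le_compat_r; [now apply pow_le|].
apply Rplus_le_compat_l, Rmult_le_compat_r; [lra|].
replace 3%R with (INR 3) by (simpl; lra); now apply le_INR.
Qed.

(** * The case [q = 0] and the conclusion *)

Lemma qpoch_inf_0_l (q : C) : qpoch_inf 0 q = 1.
Proof.
apply C_lim_seq_unique, filterlim_C_eps; intros eps; exists O; intros n _.
replace (qpoch 0 q n) with (RtoC 1).
- unfold Cminus; rewrite Cplus_opp_r, Cmod_0; apply cond_pos.
- induction n as [|n IH]; simpl; [reflexivity|rewrite <- IH; ring].
Qed.

(** Treated apart because the expansion divides by powers of [q]. Only the term [k = 0] survives,
    the exponent [k(k+3)/2] being positive for [k >= 1]. *)
Lemma lambert_series_0 :
  is_series (K := C_AbsRing) (V := C_NormedModule) (lambert_term 0) (RtoC 1).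
Proof.
apply filterlim_C_eps; intros eps; exists O; intros n _.
rewrite sum_n_csum.
replace (csum (lambert_term 0) (S n)) with (RtoC 1).
- unfold Cminus; rewrite Cplus_opp_r, Cmod_0; apply cond_pos.
- induction n as [|n IH].
  + unfold lambert_term; simpl.
    replace (1 - 0 * 1) with (RtoC 1) by ring; field; exact C1_nz.
  + change (csum (lambert_term 0) (S (S n)))
      with (csum (lambert_term 0) (S n) + lambert_term 0 (S n)).
    rewrite <- IH; unfold lambert_term.
    assert (h : (1 <= S n * (S n + 3) / 2)%nat)
      by (apply Nat.div_le_lower_bound; nia).
    destruct (S n * (S n + 3) / 2)%nat as [|e]; [lia|].
    rewrite (Cpow_S 0 e); unfold Cdiv; ring.
Qed.

Theorem theorem1p1 (q : C) (hq : Cmod q < 1) :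
  is_series (K := C_AbsRing) (V := C_NormedModule)
    (fun k : nat =>
       (- (1)) ^ k * q ^ (k * (k + 3) / 2) / (1 - q ^ (2 * k + 1)))%C
    (qpoch_inf (q ^ 2) (q ^ 2) * qpoch_inf (q ^ 8) (q ^ 8)
     / (qpoch_inf q (q ^ 2) * qpoch_inf (q ^ 4) (q ^ 8)))%C.
Proof.
change (is_series (K := C_AbsRing) (V := C_NormedModule) (lambert_term q)
    (qpoch_inf (q ^ 2) (q ^ 2) * qpoch_inf (q ^ 8) (q ^ 8)
     / (qpoch_inf q (q ^ 2) * qpoch_inf (q ^ 4) (q ^ 8)))).
destruct (Ceq_dec q 0) as [->|q0].
- replace (0 ^ 2) with (RtoC 0) by ring; replace (0 ^ 8) with (RtoC 0) by ring.
  replace (0 ^ 4) with (RtoC 0) by ring.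
  rewrite !qpoch_inf_0_l.
  replace (1 * 1 / (1 * 1)) with (RtoC 1) by (field; exact C1_nz).
  exact lambert_series_0.
- replace (qpoch_inf (q ^ 2) (q ^ 2) * qpoch_inf (q ^ 8) (q ^ 8)
     / (qpoch_inf q (q ^ 2) * qpoch_inf (q ^ 4) (q ^ 8)))
    with (/ weight_lim q * / qpoch_inf q (q ^ 2)).
  { now apply lambert_series. }
  rewrite qpoch_inf_quadrisect by exact hq; unfold weight_lim.
  assert (h := fun s hs => qpoch_inf_neq_0 q s 8 hq hs ltac:(lia)).
  assert (h1 := qpoch_inf_neq_0 q 1 2 hq ltac:(lia) ltac:(lia)).
  rewrite Cpow_1_r in h1.
  field; repeat split; try exact h1; apply h; lia.
Qed.
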